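(* Let $\mathcal{A}$ be an $m$-th order $n$-dimensional tensor. If $\mathcal{A}$ is strictly diagonally dominant and all its diagonal entries $a_{ii\ldots i}$ are positive, then $\mathcal{A}$ is a P-tensor. If $\mathcal{A}$ is diagonally dominant and all its diagonal entries are nonnegative, then $\mathcal{A}$ is a P$_0$-tensor.
   Context: An $m$-th order $n$-dimensional tensor ($m\ge 2$, $n\ge 1$) is a real array $\mathcal{A}=(a_{i_1\ldots i_m})$, $1\le i_1,\ldots,i_m\le n$ (not assumed symmetric). $\mathcal{A}\mathbf{x}^{m-1}$ is the vector with $i$-th entry $\sum_{i_2,\ldots,i_m=1}^n a_{i i_2\ldots i_m}x_{i_2}\cdots x_{i_m}$. $\mathcal{A}$ is diagonally dominant if $|a_{ii\ldots i}|\ge\sum_{(i_2,\ldots,i_m)\ne(i,\ldots,i)}|a_{i i_2\ldots i_m}|$ for all $i=1,\ldots,n$, and strictly diagonally dominant if all these inequalities are strict. $\mathcal{A}$ is a P-tensor if for each nonzero $\mathbf{x}\in\mathbb{R}^n$ there is an index $i$ with $x_i^{m-1}(\mathcal{A}\mathbf{x}^{m-1})_i>0$; it is a P$_0$-tensor if for each nonzero $\mathbf{x}\in\mathbb{R}^n$ there is an index $i$ with $x_i\ne 0$ and $x_i^{m-1}(\mathcal{A}\mathbf{x}^{m-1})_i\ge 0$. *)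

(* Defs.v *)
From mathcomp Require Import all_boot all_order all_algebra reals.

Set Implicit Arguments.
Unset Strict Implicit.
Unset Printing Implicit Defensive.

Import Order.TTheory GRing.Theory Num.Theory.
Local Open Scope ring_scope.

(* An m-th order n-dimensional tensor; the entry a_{i i_2 ... i_m} is         *)
(* A (i, [tuple i_2; ...; i_m]).  Separating the first index keeps the        *)
(* definitions free of casts between m and m.-1.+1; the type has the intended *)
(* meaning only for m > 0.                                                    *)
Definition tensor (R : realType) (m n : nat) : Type :=
  {ffun 'I_n * (m.-1).-tuple 'I_n -> R}.

Section Tensor.
Variables (R : realType) (m n : nat).
Implicit Types (A : tensor R m n) (x : 'cV[R]_n).

Definition diag_index (i : 'I_n) : (m.-1).-tuple 'I_n := nseq_tuple m.-1 i.

Definition diag_entry A (i : 'I_n) : R := A (i, diag_index i).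

(* The vector A x^{m-1}. *)
Definition tensor_apply A x : 'cV[R]_n :=
  \col_(i < n) \sum_(t : (m.-1).-tuple 'I_n)
     A (i, t) * \prod_(k < m.-1) x (tnth t k) 0.

Definition offdiag_sum A (i : 'I_n) : R :=
  \sum_(t : (m.-1).-tuple 'I_n | t != diag_index i) `|A (i, t)|.

Definition diag_dominant A : Prop :=
  forall i : 'I_n, offdiag_sum A i <= `|diag_entry A i|.

Definition strictly_diag_dominant A : Prop :=
  forall i : 'I_n, offdiag_sum A i < `|diag_entry A i|.

Definition P_tensor A : Prop :=
  forall x, x != 0 ->
  exists i : 'I_n, 0 < x i 0 ^+ m.-1 * tensor_apply A x i 0.

Definition P0_tensor A : Prop :=
  forall x, x != 0 ->
  exists i : 'I_n, x i 0 != 0 /\ 0 <= x i 0 ^+ m.-1 * tensor_apply A x i 0.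

End Tensor.

(* Main.v *)
(* Take i with |x_i| maximal.  Every off-diagonal monomial of (A x^{m-1})_i is
   bounded by |x_i|^{m-1}, so that x_i^{m-1} (A x^{m-1})_i is at least
   (a_{i...i} - sum of the off-diagonal |a_{i i_2...i_m}|) x_i^{2(m-1)}. *)
Require Import Defs.
From mathcomp Require Import all_boot all_order all_algebra reals.

Import Order.TTheory GRing.Theory Num.Theory.
Local Open Scope ring_scope.

(** A coordinate of maximal modulus dominates some nonzero coordinate, so it is itself nonzero. This
    makes x_i^{2(m-1)} positive for P-tensors and supplies the extra condition in the P_0 case. *)
Lemma exists_max_norm_coord (R : realDomainType) (n : nat) (x : 'cV[R]_n) :
  x != 0 -> exists2 i, x i 0 != 0 & forall j, `|x j 0| <= `|x i 0|.
Proof.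
case/matrix0Pn=> i0 [j0]; rewrite ord1 => xi0.
have [i _ imax] := @arg_maxP _ _ _ i0 xpredT (fun j => `|x j 0|) isT.
exists i => [|j]; last exact: imax.
by rewrite -normr_gt0 (lt_le_trans _ (imax i0 isT)) ?normr_gt0.
Qed.

Lemma tensor_apply_diag (R : realType) (m n : nat) (A : tensor R m n)
    (x : 'cV[R]_n) (i : 'I_n) :
  tensor_apply A x i 0 = diag_entry A i * x i 0 ^+ m.-1 +
    \sum_(t : (m.-1).-tuple 'I_n | t != diag_index m i)
      A (i, t) * \prod_(k < m.-1) x (tnth t k) 0.
Proof.
rewrite mxE (bigD1 (diag_index m i)) //=; congr (_ * _ + _).
rewrite (eq_bigr (fun=> x i 0)) ?prodr_const ?card_ord // => k _.
by rewrite tnth_nseq.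
Qed.

Lemma tensor_apply_max_coord_ge (R : realType) (m n : nat) (A : tensor R m n)
    (x : 'cV[R]_n) (i : 'I_n) : (forall j, `|x j 0| <= `|x i 0|) ->
  (diag_entry A i - offdiag_sum A i) * (x i 0 ^+ m.-1) ^+ 2
    <= x i 0 ^+ m.-1 * tensor_apply A x i 0.
Proof.
move=> imax; rewrite tensor_apply_diag mulrBl mulrDr.
set S := \sum_(t | _) _; set y := x i 0 ^+ m.-1.
(* The diagonal terms cancel, leaving [y * - S <= offdiag_sum A i * y ^+ 2]. *)
rewrite [y * (_ * y)]mulrCA -(expr2 y) lerD2l lerNl -mulrN.
have leS : `|S| <= offdiag_sum A i * `|y|.
  rewrite mulr_suml (le_trans (ler_norm_sum _ _ _)) // ler_sum // => t _.
  rewrite normrM ler_wpM2l // normr_prod normrX.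
  (* Writing |x_i|^{m-1} as a product over ['I_(m.-1)] allows a factor-by-factor comparison. *)
  rewrite -[m.-1 in leRHS]card_ord -prodr_const ler_prod // => k _.
  by rewrite normr_ge0 imax.
(* For even m, [y] may be negative, so both sides pass to absolute values, with y^2 = |y|^2. *)
rewrite (le_trans (ler_norm _)) // normrM normrN -[y ^+ 2]real_normK ?num_real //.
by rewrite expr2 mulrA mulrC ler_wpM2r.
Qed.

Theorem corollary4p2 (R : realType) (m n : nat) (hm : (2 <= m)%N)
    (hn : (1 <= n)%N) (A : tensor R m n) :
  (strictly_diag_dominant A -> (forall i : 'I_n, 0 < diag_entry A i) ->
     P_tensor A) /\
  (diag_dominant A -> (forall i : 'I_n, 0 <= diag_entry A i) ->
     P0_tensor A).
Proof.
split=> dom diag x /exists_max_norm_coord[i xi_neq0 imax]; exists i.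
  apply: lt_le_trans (tensor_apply_max_coord_ge _ _ _ A _ _ imax).
  rewrite mulr_gt0 ?exprn_even_gt0 ?expf_neq0 // subr_gt0.
  (* Dominance bounds the modulus of the diagonal entry; the sign hypothesis identifies that modulus
     with the entry itself. *)
  by rewrite -[ltRHS]gtr0_norm ?dom.
split=> //; apply: le_trans (tensor_apply_max_coord_ge _ _ _ A _ _ imax).
by rewrite mulr_ge0 ?sqr_ge0 // subr_ge0 -[leRHS]ger0_norm ?dom.
Qed.
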